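(* Let $X,Y,Z$ be sorts of a graded probability space. Suppose that $E\in\mathcal{B}_{X\times Y\times Z}$ and $E_x\in\mathcal{B}_{Y\times Z}$ is $\mu$-stable for almost all $x\in X$. Then there is a partition of $X\times Y$ into countably many sets $A^i\in\mathcal{B}^E_{X\times Y}$, $i\in\omega$, so that for almost every $x\in X$, $(A^i_x:i\in\omega)$ is a partition of $Y$ into countably many sets perfect for $E_x$ (viewed as a binary relation on $Y\times Z$).
   Context: Graded probability space: fix base sets $V_1,\dots,V_k$; a sort is any finite cartesian product of the $V_i$'s, in any order and possibly with repetitions. A ($k$-partite) graded probability space specifies for each sort $X$ a $\sigma$-algebra $\mathcal{B}_X\subseteq\mathcal{P}(X)$ and a countably additive probability measure $\mu_X$ on it (both often written without subscript) such that for all sorts $X,Y$: $\mathcal{B}_{X\times Y}\supseteq\mathcal{B}_X\times\mathcal{B}_Y$ and $\mu_{X\times Y}$ extends the product measure; permuting coordinates preserves measurability and measure; and (Fubini) for $A\in\mathcal{B}_{X\times Y}$, $A_y\in\mathcal{B}_X$ for $\mu_Y$-almost every $y$, $y\mapsto\mu_X(A_y)$ is $\mu_Y$-measurable and $\mu_{X\times Y}(A)=\int_Y\mu_X(A_y)\,d\mu_Y$. Subscripts denote fibers: $E_x=\{(y,z):(x,y,z)\in E\}$, $A^i_x=\{y:(x,y)\in A^i\}$. $\mu$-stability: for $R\in\mathcal{B}_{X\times Y}$ and $d\ge1$, let $\mathrm{Tree}^{R,d}\subseteq X^{2^d}\times Y^{2^d-1}$ be the set of tuples $(a_\sigma:\sigma\in2^d)^\frown(b_\sigma:\sigma\in2^{<d})$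 with $(a_\sigma,b_{\sigma|_i})\in R\iff\sigma(i)=1$ for all $\sigma\in2^d$ (0-1 sequences of length $d$), $i<d$, where $\sigma|_i$ is the initial segment of length $i$. $R$ is $d$-$\mu$-stable if $\mu(\mathrm{Tree}^{R,d})=0$, and $\mu$-stable if it is $d$-$\mu$-stable for some $d$. Perfect sets: for $R\in\mathcal{B}_{X\times Y}$, $A\in\mathcal{B}_X$ is perfect for $R$ if for $\mu_Y$-almost every $b\in Y$, $\mu(A\cap R_b)=0$ or $\mu(A\setminus R_b)=0$ (where $R_b=\{a:(a,b)\in R\}$). Algebras of fibers: let $E\in\mathcal{B}_W$ with $W=\prod_{t\in[K]}V_{i_t}$. For $I\subseteq[K]$ and $W_I=\prod_{t\in I}V_{i_t}$, let $\mathcal{F}^{0,E}_{W_I}$ be the collection of all fibers $E_{\bar b}\subseteq W_I$, $\bar b\in\prod_{t\in[K]\setminus I}V_{i_t}$, and their complements (all these are taken to be in $\mathcal{B}_{W_I}$). For a sort $S=\prod_{t\in[L]}V_{j_t}$, $\mathcal{F}^{E,N}_S$ is the collection of sets $\{(b_i:i\in[L])\in S:\bigwedge_{\ell\in[N]}(b_i:i\in J_\ell)\in S_\ell\}$ with $J_\ell\subseteq[L]$, $I_\ell\subseteq[K]$, $(j_t:t\in J_\ell)=(i_t:t\in I_\ell)$ and $S_\ell\in\mathcal{F}^{0,E}_{W_{I_\ell}}$. $\mathcal{B}^E_S$ is the $\sigma$-algebra generated by $\bigcup_N\mathcal{F}^{E,N}_S$. *)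

(* Defs.v *)
From HB Require Import structures.
From mathcomp Require Import all_boot all_order all_algebra.
From mathcomp Require Import all_classical all_reals all_analysis.
From mathcomp Require Import measurable_realfun.

Set Implicit Arguments.
Unset Strict Implicit.
Unset Printing Implicit Defensive.

Local Open Scope classical_set_scope.

(** A sort is a finite sequence of base sets, given as a family of indices in
    ['I_k] over a finite type of positions.  Positions are ordered by [enum]:
    this is the usual order on ordinals, and it lists the positions of a sum
    [I + J] as those of [I] followed by those of [J].  Allowing any finite type
    of positions, and not just ordinals, makes the projections of a product of
    sorts, and coordinate permutations, free of type casts. *)
Record gsort (k : nat) := Sort { pos : finType; base : pos -> 'I_k }.

Section Points.
Context (k : nat) (V : 'I_k -> pointedType).
Implicit Types X Y : gsort k.

Definition pt X : Type := forall t : pos X, V (base t).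

Definition prodS X Y : gsort k :=
  Sort (fun t : pos X + pos Y =>
    match t with inl i => base i | inr j => base j end).

Definition powS X (T : finType) : gsort k :=
  Sort (fun t : T * pos X => base t.2).

Definition permS X (T : finType) (s : T -> pos X) : gsort k :=
  Sort (fun t : T => base (s t)).

Definition subS X (I : {set pos X}) : gsort k :=
  Sort (fun t : {t : pos X | t \in I} => base (val t)).

Definition pairp X Y (x : pt X) (y : pt Y) : pt (prodS X Y) :=
  fun t => match t with inl i => x i | inr j => y j end.

Definition leftp X Y (p : pt (prodS X Y)) : pt X := fun i => p (inl i).

Definition rightp X Y (p : pt (prodS X Y)) : pt Y := fun j => p (inr j).

Definition compp X (T : finType) (a : pt (powS X T)) (s : T) : pt X :=
  fun i => a (s, i).

Definition permp X (T : finType) (s : T -> pos X) (p : pt X) : pt (permS s) :=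
  fun t => p (s t).

Definition restrp X (I : {set pos X}) (p : pt X) : pt (subS I) :=
  fun t => p (val t).

(** [fiber A x] is the fiber of [A] over a point of the first factor, and
    [cofiber A y] the fiber over a point of the second factor. *)
Definition fiber X Y (A : set (pt (prodS X Y))) (x : pt X) : set (pt Y) :=
  [set y | A (pairp x y)].

Definition cofiber X Y (A : set (pt (prodS X Y))) (y : pt Y) : set (pt X) :=
  [set x | A (pairp x y)].

End Points.

Arguments permp {k V X T} s p _.
Arguments restrp {k V X} I p _.

(** [measS X] is the sigma-algebra of the sort [X].  As it is a sigma-algebra,
    it is the class of measurable sets of [g_sigma_algebraType (measS X)].

    The base sets are pointed since the library only puts generated
    sigma-algebras on pointed types; a set carrying a probability measure is
    nonempty anyway.

    In [gps_fubini], the fibers [A_y] are only measurable for almost every [y],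
    so that [y |-> mu_X A_y] is only defined almost everywhere: that it is
    measurable means that it agrees almost everywhere with a measurable function
    [g], which is then the integrand. *)
Record gradedProbSpace (R : realType) (k : nat) (V : 'I_k -> pointedType) :=
  GradedProbSpace {
  measS : forall X : gsort k, set_system (pt V X);
  sigma_algebra_measS : forall X : gsort k, sigma_algebra setT (@measS X);
  muS : forall X : gsort k, probability (g_sigma_algebraType (@measS X)) R;
  gps_prod : forall (X Y : gsort k)
      (A : set (g_sigma_algebraType (@measS X) * g_sigma_algebraType (@measS Y))),
    measurable A ->
    let A' := [set p : pt V (prodS X Y) | A (leftp p, rightp p)] in
    measS A' /\ muS (prodS X Y) A' = (muS X \x muS Y)%E A;
  gps_perm : forall (X : gsort k) (T : finType) (s : T -> pos X),
    bijective s -> forall A : set (pt V X), measS A ->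
    measS (permp s @` A) /\ muS (permS s) (permp s @` A) = muS X A;
  gps_fubini : forall (X Y : gsort k) (A : set (pt V (prodS X Y))),
    measS A ->
    exists g : g_sigma_algebraType (@measS Y) -> \bar R,
      [/\ measurable_fun setT g,
          {ae muS Y, forall y, measS (cofiber A y) /\ g y = muS X (cofiber A y)}
        & muS (prodS X Y) A = (\int[muS Y]_y g y)%E] }.

Arguments measS {R k V} g {X} _.
Arguments muS {R k V} g X.

Section Stability.
Context (R : realType) (k : nat) (V : 'I_k -> pointedType)
  (G : gradedProbSpace R V).
Implicit Types X Y : gsort k.

(** The 0-1 sequences of length less than [d]. *)
Definition short_word (d : nat) : finType := {n : 'I_d & n.-tuple bool}.

Definition prefix_word d (s : d.-tuple bool) (i : 'I_d) : short_word d :=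
  Tagged (fun n : 'I_d => n.-tuple bool)
    [tuple tnth s (widen_ord (ltnW (ltn_ord i)) j) | j < i].

Definition treeS X Y (d : nat) : gsort k :=
  prodS (powS X (d.-tuple bool)) (powS Y (short_word d)).

Definition tree X Y (E : set (pt V (prodS X Y))) (d : nat) :
    set (pt V (treeS X Y d)) :=
  [set p | forall (s : d.-tuple bool) (i : 'I_d),
    E (pairp (compp (leftp p) s) (compp (rightp p) (prefix_word s i)))
    <-> tnth s i].
Arguments tree {X Y} E d _.

Definition dmu_stable X Y (d : nat) (E : set (pt V (prodS X Y))) : Prop :=
  muS G (treeS X Y d) (tree E d) = 0%E.

Definition mu_stable X Y (E : set (pt V (prodS X Y))) : Prop :=
  exists2 d : nat, (0 < d)%N & dmu_stable d E.

Definition perfect_for X Y (E : set (pt V (prodS X Y))) (A : set (pt V X)) :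
    Prop :=
  measS G A /\
  {ae muS G Y, forall b, muS G X (A `&` cofiber E b) = 0%E \/
                         muS G X (A `\` cofiber E b) = 0%E}.

End Stability.

Section FiberAlgebra.
Context (k : nat) (V : 'I_k -> pointedType).
Context (W : gsort k) (E : set (pt V W)).

(** The fiber of [E] in [W_I] over a point [b] whose coordinates are indexed by
    the complement of [I]. *)
Definition subfiber (I : {set pos W}) (b : pt V (subS (~: I))) :
    set (pt V (subS I)) :=
  restrp I @` (E `&` restrp (~: I) @^-1` [set b]).

Definition fibers0 (I : {set pos W}) : set_system (pt V (subS I)) :=
  [set C | exists b, C = subfiber b \/ C = ~` subfiber b].
Arguments fibers0 I _ : clear implicits.

(** The sequence of coordinates of a point, each tagged with the index of its
    base set; it serves to identify points of two sorts given by the same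
    sequence of base sets but with different types of positions. *)
Definition coords (X : gsort k) (p : pt V X) : seq {i : 'I_k & V i} :=
  [seq Tagged V (p t) | t <- enum (pos X)].

Definition fibersN (S : gsort k) (N : nat) : set_system (pt V S) :=
  [set C | exists (J : 'I_N -> {set pos S}) (I : 'I_N -> {set pos W})
      (D : forall l : 'I_N, set (pt V (subS (I l)))),
    [/\ forall l, [seq base t | t <- enum (J l)] =
                  [seq base t | t <- enum (I l)],
        forall l, fibers0 (I l) (D l)
      & C = [set b | forall l, exists2 c, D l c &
                       coords c = coords (restrp (J l) b)]]].
Arguments fibersN S N _ : clear implicits.

(** The sigma-algebra generated by the fibers of [E] on the sort [S]. *)
Definition fiber_algebra (S : gsort k) : set_system (pt V S) :=
  <<s \bigcup_N fibersN S N >>.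

End FiberAlgebra.

Arguments fibers0 {k V W} E I _.
Arguments fibersN {k V W} E S N _.
Arguments fiber_algebra {k V W} E S _.

(** The standing assumption that every fiber of [E] is measurable. *)
Definition fibers_measurable (R : realType) (k : nat) (V : 'I_k -> pointedType)
    (G : gradedProbSpace R V) (W : gsort k) (E : set (pt V W)) : Prop :=
  forall I : {set pos W}, fibers0 E I `<=` measS G.

(** A partition into countably many sets, some of which may be empty: the
    library's [partition] requires nonempty parts. *)
Definition countable_partition (T : Type) (A : nat -> set T) : Prop :=
  trivIset setT A /\ \bigcup_i A i = setT.

(* Main.v *)
Require Import Defs.
From mathcomp Require Import all_boot all_order all_algebra.
From mathcomp Require Import all_classical all_reals all_analysis.
From mathcomp Require Import measurable_realfun.

Set Implicit Arguments.
Unset Strict Implicit.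
Unset Printing Implicit Defensive.

Import Order.TTheory GRing.Theory Num.Theory.
Local Open Scope classical_set_scope.

(** Up to null sets, perfection of the fiber [A_x] of a set [A] for [E_x] says
    that almost no [(z, y, y')] has [y, y'] in [A_x], [(y, z)] outside [E_x] and
    [(y', z)] in [E_x].  Whether the measure of such a fiber is positive is
    decided, for almost every [x], by countably many well-chosen points, so that
    the [x] where [A_x] is not perfect can be removed from [A] without leaving
    the sigma-algebra generated by the fibers [E_z] and [E_(y,z)].
    Exhaust [X * Y], up to a null set, by countably many sets of this algebra
    with almost all fibers perfect, and let [D] be the rest.  Then almost every
    nonnull fiber [B_x] of a subset [B] of [D] in the algebra is not perfect,
    hence is split by positively many [z] into two nonnull pieces, which are
    fibers of subsets of [D] in the algebra.  Iterating, if [D_x] is not null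
    then it contains the leaves of a nonnull set of trees of [E_x] of every
    depth, against stability; so almost all [D_x] are null. *)

(** * Exhausting a probability space by countably many sets of a family *)

Section Exhaustion.
Context d (T : measurableType d) (R : realType) (mu : probability T R).

(** A countable union of members whose measure is the supremum over all countable unions can gain
    only a null set from a further member. The supremum is attained by merging a maximizing sequence
    of countable unions into one. *)
Lemma exhaustion (F : set_system T) :
  F !=set0 -> F `<=` measurable ->
  exists2 A : nat -> set T, (forall n, F (A n)) &
    forall B, F B -> mu.-negligible (B `\` \bigcup_n A n).
Proof.
move=> [F0 FF0] Fm.
pose S := [set mu (\bigcup_n A n) |
  A in [set A : nat -> set T | forall n, F (A n)]].
have mU (A : nat -> set T) : (forall n, F (A n)) -> measurable (\bigcup_n A n).
  by move=> FA; apply: bigcupT_measurable => n; exact/Fm/FA.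
have S0 : S != set0.
  by apply/set0P; exists (mu (\bigcup_(n : nat) F0)); exists (fun=> F0).
have [u Su us] := ereal_sup_seq S0.
have /choice[A AE] : forall n, exists A : nat -> set T,
    (forall m, F (A m)) /\ mu (\bigcup_m A m) = u n.
  by move=> n; have [A FA <-] := Su n; exists A.
(* All the [A n m] in one sequence; numbers that encode no pair fall back on [A 0 0]. *)
pose C n := let p := odflt (0%N, 0%N) (unpickle n) in A p.1 p.2.
have FC n : F (C n).
  by have [+ _] := AE (odflt (0%N, 0%N) (unpickle n)).1; exact.
have ub (B : nat -> set T) : (forall n, F (B n)) ->
    (mu (\bigcup_n B n) <= mu (\bigcup_n C n))%E.
  move=> FB; apply: (@le_trans _ _ (ereal_sup S)).
    by apply: ereal_sup_ubound; exists B.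
  have -> : ereal_sup S = limn u by exact/esym/cvg_lim.
  apply: lime_le; first by apply/cvg_ex; exists (ereal_sup S).
  apply: nearW => n; have [FA <-] := AE n.
  apply: le_measure; rewrite ?inE; [exact: mU|exact: mU|].
  by move=> t [m _ At]; exists (pickle (n, m)) => //; rewrite /C pickleK.
exists C => // B FB.
have mB : measurable (B `\` \bigcup_n C n).
  by apply: measurableD; [exact: Fm|exact: mU].
apply/negligibleP => //.
(* Prepending [B] to [C] gives another competitor for the supremum. *)
pose D n := if n is m.+1 then C m else B.
have FD n : F (D n) by case: n.
have := ub D FD.
have -> : \bigcup_n D n = (B `\` \bigcup_n C n) `|` \bigcup_n C n.
  apply/seteqP; split => t.
    move=> [[|n] _ Dt]; last by right; exists n.
    by have [?|?] := pselect ((\bigcup_n C n) t); [right|left].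
  by move=> [[Bt _]|[n _ Ct]]; [exists 0%N|exists n.+1].
rewrite measureU//; [|exact: mU|by apply/seteqP; split => t // -[[]]].
have fU : mu (\bigcup_n C n) \is a fin_num by exact/fin_num_measure/mU.
rewrite -leeBrDr// subee// => le0.
by apply/eqP; rewrite -measure_le0.
Qed.

End Exhaustion.

(** * Coordinate maps between sorts *)

Section Sorts.
Context (k : nat) (V : 'I_k -> pointedType).
Implicit Types X Y : gsort k.

(** [f] reads each coordinate [t] of its value off the coordinate [s t] of its
    argument; comparing tagged values spares casts between [V (base t)] and
    [V (base (s t))]. *)
Definition coordinate_map X Y (s : pos Y -> pos X) (f : pt V X -> pt V Y) :=
  forall p t, Tagged V (f p t) = Tagged V (p (s t)).

Lemma Tagged_inj (i : 'I_k) : injective (fun v : V i => Tagged V v).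
Proof. by move=> v w /eqP; rewrite eq_Tagged => /eqP. Qed.

Lemma pt_ext X (p q : pt V X) :
  (forall t, Tagged V (p t) = Tagged V (q t)) -> p = q.
Proof.
move=> pq; apply: functional_extensionality_dep => t.
exact: Tagged_inj (pq t).
Qed.

Lemma pairpK X Y (p : pt V (prodS X Y)) : pairp (leftp p) (rightp p) = p.
Proof. by apply: functional_extensionality_dep => -[]. Qed.

End Sorts.

(** * Measurable and null sets under coordinate maps, and Fubini for cofibers *)

Section Calculus.
Context (R : realType) (k : nat) (V : 'I_k -> pointedType)
  (G : gradedProbSpace R V).
Implicit Types X Y Z : gsort k.

Local Notation negl := (muS G _).-negligible.

Lemma measSE X :
  @measurable _ (g_sigma_algebraType (@measS R k V G X)) = measS G.
Proof. exact/sigma_algebra_id/sigma_algebra_measS. Qed.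

Lemma measS_measurable X (A : set (pt V X)) :
  measS G A -> @measurable _ (g_sigma_algebraType (@measS R k V G X)) A.
Proof. by rewrite measSE. Qed.

Lemma measurable_measS X (A : set (pt V X)) :
  @measurable _ (g_sigma_algebraType (@measS R k V G X)) A -> measS G A.
Proof. by rewrite measSE. Qed.

Lemma negl_measS X (A : set (pt V X)) :
  measS G A -> muS G X A = 0%E <-> negl A.
Proof. by move=> /measS_measurable mA; apply: iff_sym; exact: negligibleP. Qed.

Lemma measSI X (A B : set (pt V X)) :
  measS G A -> measS G B -> measS G (A `&` B).
Proof. by rewrite -measSE; exact: measurableI. Qed.

Lemma measSC X (A : set (pt V X)) : measS G A -> measS G (~` A).
Proof. by rewrite -measSE; exact: measurableC. Qed.

Lemma measSD X (A B : set (pt V X)) :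
  measS G A -> measS G B -> measS G (A `\` B).
Proof. by rewrite -measSE; exact: measurableD. Qed.

Lemma measST X : measS G (setT : set (pt V X)).
Proof. by rewrite -measSE; exact: measurableT. Qed.

Lemma measS_forall (I : finType) X (A : I -> set (pt V X)) :
  (forall i, measS G (A i)) -> measS G [set p | forall i, A i p].
Proof.
rewrite -measSE => mA.
have -> : [set p | forall i, A i p] = \bigcap_(i in setT) A i.
  by apply/seteqP; split => p h i; [move=> _; exact: h|exact: h].
by apply: fin_bigcap_measurable => //; exact: finite_finset.
Qed.

Lemma measS_iff X (A : set (pt V X)) (b : bool) :
  measS G A -> measS G [set p | A p <-> b].
Proof.
move=> mA; case: b.
  by rewrite (_ : [set _ | _] = A)//; apply/seteqP; split => p /=; intuition.
rewrite (_ : [set _ | _] = ~` A); first exact: measSC.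
by apply/seteqP; split => p /=; intuition.
Qed.

(** Once the base maps agree, [X] is literally [permS s'], with [s'] the inverse of [s], and [f]
    inverts [permp s']. The preimage under [f] is thus an image under [permp s'], to which
    [gps_perm] applies. *)
Lemma coordinate_map_bij X Y (s : pos Y -> pos X) (f : pt V X -> pt V Y) A :
  bijective s -> coordinate_map s f -> measS G A ->
  measS G (f @^-1` A) /\ muS G X (f @^-1` A) = muS G Y A.
Proof.
move=> [s' sK s'K] sf mA.
have bE : (fun t => base (s' t)) = @base k X.
  (* The tags of the values at an arbitrary point carry the indices of the base sets. *)
  apply/funext => t; pose x0 : pt V X := fun=> point.
  by have /(congr1 (fun u => projT1 u)) /= -> := sf x0 (s' t); rewrite s'K.
(* With the base map of [X] exposed as a variable, [subst] identifies the two sorts without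
   casts. *)
case: X s f s' sK s'K sf bE => P b /= s f s' sK s'K sf bE; subst b.
have := gps_perm (g:=G) (X:=Y) (T:=P) (s:=s') _ mA.
suff -> : f @^-1` A = permp s' @` A by apply; exists s.
apply/seteqP; split => [p Ap|_ [p Ap <-]] /=.
  exists (f p) => //; apply: pt_ext => t.
  by rewrite /permp sf /= s'K.
rewrite (_ : f _ = p)//; apply: pt_ext => t.
by rewrite sf /permp /= sK.
Qed.

Lemma measS_leftp X Y (A : set (pt V X)) : measS G A ->
  measS G (@leftp k V X Y @^-1` A) /\
  muS G (prodS X Y) (@leftp k V X Y @^-1` A) = muS G X A.
Proof.
move=> /measS_measurable mA'.
have [] := gps_prod (g:=G) (X:=X) (Y:=Y) (measurableX mA' (measurableT)).
rewrite product_measure1E// [X in (_ * X)%E]probability_setT mule1.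
rewrite (_ : [set _ | _] = @leftp k V X Y @^-1` A)//.
by apply/seteqP; split => p /=; intuition.
Qed.

(** The positions outside the image of [s] form a second factor [C]; then [f] is a bijective
    coordinate map onto [prodS Y C] followed by the left projection. *)
Lemma coordinate_map_preimage X Y (s : pos Y -> pos X)
    (f : pt V X -> pt V Y) A :
  injective s -> coordinate_map s f -> measS G A ->
  measS G (f @^-1` A) /\ muS G X (f @^-1` A) = muS G Y A.
Proof.
move=> sI sf mA.
pose C := Sort (fun t : {t : pos X | t \notin codom s} => base (val t)).
pose s1 (t : pos (prodS Y C)) := match t with inl i => s i | inr j => val j end.
pose f1 (p : pt V X) : pt V (prodS Y C) :=
  pairp (f p) ((fun t => p (val t)) : pt V C).
have s1I : injective s1.
  move=> [i|i] [j|j] //=; first by move/sI ->.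
  - by move=> e; have := valP j; rewrite -[val j]e codom_f.
  - by move=> e; have := valP i; rewrite [val i]e codom_f.
  - by move/val_inj ->.
have s1S x : x \in codom s1.
  have [/codomP[t ->]|xs] := boolP (x \in codom s).
    by apply/codomP; exists (inl t).
  by apply/codomP; exists (inr (exist _ x xs)).
have s1b : bijective s1.
  exists (fun x => iinv (s1S x)) => x; last exact: f_iinv.
  by apply: s1I; rewrite f_iinv.
have sf1 : coordinate_map s1 f1 by move=> p [i|j] //=; exact: sf.
have [mL <-] := measS_leftp C mA.
exact: (coordinate_map_bij s1b sf1 mL).
Qed.

Lemma measS_preimage X Y (s : pos Y -> pos X) (f : pt V X -> pt V Y) A :
  injective s -> coordinate_map s f -> measS G A -> measS G (f @^-1` A).
Proof. by move=> sI sf /(coordinate_map_preimage sI sf)[]. Qed.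

Lemma negl_preimage X Y (s : pos Y -> pos X) (f : pt V X -> pt V Y) A :
  injective s -> coordinate_map s f -> negl A -> negl (f @^-1` A).
Proof.
move=> sI sf [B [mB B0 AB]].
have [mfB fB] := coordinate_map_preimage (A := B) sI sf (measurable_measS mB).
have : negl (f @^-1` B) by apply/negl_measS => //; rewrite fB.
by apply: negligibleS => p /AB.
Qed.

#[global] Instance ae_muS_filter X :
  Filter (nbhs (almost_everywhere (muS G X))).
Proof. exact: ae_filter_ringOfSetsType. Qed.

(** The integrand [g] agrees almost everywhere with the measure of the cofiber: [Q] is the set where
    [g] does not vanish, and [A] is null exactly when [g] vanishes almost everywhere. *)
Lemma fubini_cofiber X Y (A : set (pt V (prodS X Y))) :
  measS G A ->
  [/\ {ae muS G Y, forall y, measS G (cofiber A y)},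
      exists2 Q, measS G Q &
        {ae muS G Y, forall y, Q y <-> ~ negl (cofiber A y)}
    & negl A <-> {ae muS G Y, forall y, negl (cofiber A y)}].
Proof.
move=> mA; have [g [mg gE muA]] := gps_fubini mA; split.
- by apply: filterS gE => y [].
- exists [set y | g y != 0%E].
    apply: measurable_measS; rewrite -[[set _ | _]]setTI.
    exact: measurable_neqe.
  apply: filterS gE => y [mAy gy] /=; rewrite -negl_measS// gy.
  by split => [/eqP//|/eqP].
- rewrite -negl_measS// muA.
  (* [g] is known to be nonnegative only almost everywhere, while the criterion for a vanishing
     integral is about its absolute value. *)
  have -> : (\int[muS G Y]_y g y = \int[muS G Y]_y `|g y|)%E.
    apply: ae_eq_integral => //; first exact: measurableT_comp.
    apply: filterS gE => y [mAy gy] _; rewrite gy gee0_abs//.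
  rewrite (ae_eq_integral_abs _ _ mg)//; split=> h.
    apply: filterS2 h gE => y /(_ I) gy0 [mAy gy].
    by apply/negl_measS => //; rewrite -gy.
  apply: filterS2 h gE => y Ay0 [mAy gy] _ /=.
  by rewrite gy; apply/negl_measS.
Qed.

End Calculus.

Lemma filterS4 (T : Type) (F : set_system T) :
  Filter F -> forall P Q R S U : set T,
  (forall x, P x -> Q x -> R x -> S x -> U x) ->
  F P -> F Q -> F R -> F S -> F U.
Proof.
move=> FF P Q R S U PU FP FQ FR FS.
apply: filterS2 (filterI FP FQ) (filterI FR FS) => x [Px Qx] [Rx Sx].
exact: PU.
Qed.

(** * Fubini for fibers, null rectangles, and countable detection of nonnull fibers *)

Section Fubini.
Context (R : realType) (k : nat) (V : 'I_k -> pointedType)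
  (G : gradedProbSpace R V).
Implicit Types X Y Z : gsort k.

Local Notation negl := (muS G _).-negligible.

Definition swapp X Y (p : pt V (prodS X Y)) : pt V (prodS Y X) :=
  pairp (rightp p) (leftp p).

Lemma swap_preimage X Y (A : set (pt V (prodS Y X))) :
  measS G A -> measS G (@swapp X Y @^-1` A).
Proof.
apply: (@measS_preimage _ _ _ _ (prodS X Y) (prodS Y X)
  (fun t => match t with inl i => inr i | inr j => inl j end)).
  by move=> [i|i] [j|j] // [->].
by move=> p [].
Qed.

Lemma negl_swap X Y (A : set (pt V (prodS Y X))) :
  negl A -> negl (@swapp X Y @^-1` A).
Proof.
apply: (@negl_preimage _ _ _ _ (prodS X Y) (prodS Y X)
  (fun t => match t with inl i => inr i | inr j => inl j end)).
  by move=> [i|i] [j|j] // [->].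
by move=> p [].
Qed.

Lemma fubini_fiber X Y (A : set (pt V (prodS X Y))) :
  measS G A ->
  [/\ {ae muS G X, forall x, measS G (fiber A x)},
      exists2 Q, measS G Q &
        {ae muS G X, forall x, Q x <-> ~ negl (fiber A x)}
    & negl A <-> {ae muS G X, forall x, negl (fiber A x)}].
Proof.
move=> mA; have [h1 h2 h3] := fubini_cofiber (swap_preimage mA).
split => //; apply: iff_trans h3; split => [|/(@negl_swap X Y)].
  exact: negl_swap.
by apply: negligibleS => p; rewrite /= /swapp /= pairpK.
Qed.

Lemma negl_fiber X Y (A : set (pt V (prodS X Y))) :
  negl A -> {ae muS G X, forall x, negl (fiber A x)}.
Proof.
move=> [B [mB B0 AB]].
have {}mB := measurable_measS mB.
have [_ _ [+ _]] := fubini_fiber mB.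
move=> /(_ ((negl_measS mB).1 B0)); apply: filterS => x.
by apply: negligibleS => y /AB.
Qed.

Lemma negl_cofiber X Y (A : set (pt V (prodS X Y))) :
  negl A -> {ae muS G Y, forall y, negl (cofiber A y)}.
Proof. by move=> /(@negl_swap Y X)/negl_fiber. Qed.

Lemma ae_fiber X Y (P : pt V (prodS X Y) -> Prop) :
  {ae muS G (prodS X Y), forall p, P p} ->
  {ae muS G X, forall x, {ae muS G Y, forall y, P (pairp x y)}}.
Proof. exact: negl_fiber. Qed.

Lemma ae_cofiber X Y (P : pt V (prodS X Y) -> Prop) :
  {ae muS G (prodS X Y), forall p, P p} ->
  {ae muS G Y, forall y, {ae muS G X, forall x, P (pairp x y)}}.
Proof. exact: negl_cofiber. Qed.

Lemma negl_ae X (A : set (pt V X)) :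
  negl A <-> {ae muS G X, forall x, ~ A x}.
Proof.
by split; apply: negligibleS => x /=; [exact: contrapT|move=> Ax; apply].
Qed.

Definition rect X Y (A : set (pt V X)) (B : set (pt V Y)) :
  set (pt V (prodS X Y)) := [set p | A (leftp p) /\ B (rightp p)].

(** If [B] is not null, every point of [A] has a nonnull fiber in the rectangle, and such points
    form a null set. *)
Lemma negl_rect X Y (A : set (pt V X)) (B : set (pt V Y)) :
  negl (rect A B) -> negl A \/ negl B.
Proof.
move=> /negl_fiber h; have [?|nB] := pselect (negl B); first by right.
left; apply: negligibleS h => x Ax /= nBx; apply: nB.
by apply: negligibleS nBx => y By.
Qed.

Lemma negl_leftp X Y (A : set (pt V X)) :
  negl A -> negl (@leftp k V X Y @^-1` A).
Proof. by apply: (@negl_preimage _ _ _ _ (prodS X Y) X inl) => // i j []. Qed.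

Lemma negl_rightp X Y (A : set (pt V Y)) :
  negl A -> negl (@rightp k V X Y @^-1` A).
Proof. by apply: (@negl_preimage _ _ _ _ (prodS X Y) Y inr) => // i j []. Qed.

Lemma rect_negl X Y (A : set (pt V X)) (B : set (pt V Y)) :
  negl A \/ negl B -> negl (rect A B).
Proof.
by move=> [/(@negl_leftp X Y)|/(@negl_rightp X Y)]; apply: negligibleS => p [].
Qed.

Definition assocp X Y Z (p : pt V (prodS (prodS X Y) Z)) :
    pt V (prodS X (prodS Y Z)) :=
  pairp (leftp (leftp p)) (pairp (rightp (leftp p)) (rightp p)).

Lemma assocp_preimage X Y Z (A : set (pt V (prodS X (prodS Y Z)))) :
  measS G A -> measS G (@assocp X Y Z @^-1` A).
Proof.
apply: (@measS_preimage _ _ _ _ (prodS (prodS X Y) Z) (prodS X (prodS Y Z))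
  (fun t => match t with
  | inl i => inl (inl i) | inr (inl j) => inl (inr j) | inr (inr l) => inr l
  end)).
  by move=> [i|[i|i]] [j|[j|j]] // [->].
by move=> p [|[]].
Qed.

(** The hypothesis is for each [z] separately: as nullity of fibers is
    measurable up to null sets, the two variables can be exchanged. *)
Lemma negl_fiber_trans X Z P Q (C : set (pt V (prodS X (prodS Z P))))
    (U : set (pt V (prodS X (prodS Z Q)))) :
  measS G C -> measS G U ->
  (forall z, {ae muS G X, forall x,
     negl (fiber (fiber U x) z) -> negl (fiber (fiber C x) z)}) ->
  {ae muS G X, forall x, negl (fiber U x) -> negl (fiber C x)}.
Proof.
move=> mC mU CU.
have [_ [QC mQC QCE] _] := fubini_fiber (assocp_preimage mC).
have [_ [QU mQU QUE] _] := fubini_fiber (assocp_preimage mU).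
(* Up to null sets, [QC] without [QU] consists of the pairs [(x, z)] that violate the implication.
   Its cofibers over almost all [z] are null by hypothesis, hence it is null. *)
have mbad : measS G (QC `\` QU) by exact: measSD.
have good : {ae muS G (prodS X Z), forall p, ~ (QC `\` QU) p}.
  apply/(@negl_ae _ (QC `\` QU)).
  have [_ _ [_ +]] := fubini_cofiber mbad; apply.
  have := ae_cofiber QCE; have := ae_cofiber QUE.
  apply: filterS2 => z hU hC.
  apply/(@negl_ae _ (cofiber (QC `\` QU) z)); move: (CU z) hU hC.
  apply: filterS3 => x /= CUx hU hC [].
  by rewrite hU hC => nC /contrapT nU; exact: nC (CUx nU).
have [mCx _ _] := fubini_fiber mC.
have := ae_fiber QCE; have := ae_fiber QUE; have := ae_fiber good.
move=> h1 h2 h3; move: mCx h1 h2 h3; apply: filterS4 => x mCx h1 h2 h3 nUx.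
have [_ _ [_ +]] := fubini_fiber mCx; apply.
suff : {ae muS G Z, forall z, negl (fiber (fiber C x) z)} by [].
move: (negl_fiber nUx) h1 h2 h3; apply: filterS4 => z nU nbad hU hC.
apply: contrapT => nC; apply: nbad; split; first exact/hC.
by move/hU; apply.
Qed.

(** The points [w j] come from exhausting [X] by cofibers of [C]. Where the fiber of [C] is nonnull
    but no [w j] hits it, maximality makes almost all cofibers null, so by Fubini almost no such [x]
    exists. *)
Lemma countable_hitting_points X W (C : set (pt V (prodS X W))) :
  measS G C -> exists w : nat -> pt V W,
    {ae muS G X, forall x,
      (exists j, C (pairp x (w j))) <-> ~ negl (fiber C x)}.
Proof.
move=> mC; have [_ [Q mQ QE] _] := fubini_fiber mC.
have [mCw _ _] := fubini_cofiber mC.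
(* Goodness gives the other direction: a hit by a good point forces [Q], for almost every [x]. *)
pose good w := measS G (cofiber C w) /\ negl (cofiber C w `\` Q).
have mleftQ : measS G (@leftp k V X W @^-1` Q) by case: (measS_leftp W mQ).
have goodE : {ae muS G W, forall w, good w}.
  have mD : measS G (C `\` @leftp k V X W @^-1` Q) by exact: measSD.
  have : negl (C `\` @leftp k V X W @^-1` Q).
    have [_ _ [_ +]] := fubini_fiber mD; apply.
    apply: filterS QE => x QxE.
    have [Qx|nQx] := pselect (Q x).
      by apply: negligibleS (negligible_set0 _) => w [_ /(_ Qx)].
    have /contrapT : ~ ~ negl (fiber C x) by move/QxE.
    by apply: negligibleS => w [].
  by move/negl_cofiber; apply: filterS2 mCw => w mw nw; split.
have goodNE : [set cofiber C w | w in good] !=set0.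
  apply: contrapT => ng; have : negl (setT : set (pt V W)).
    by apply: negligibleS goodE => w _ gw; apply: ng; exists (cofiber C w), w.
  move/(measure_negligible measurableT); rewrite [LHS]probability_setT.
  by move/eqP; rewrite onee_eq0.
have goodm : [set cofiber C w | w in good] `<=`
    @measurable _ (g_sigma_algebraType (@measS R k V G X)).
  by move=> _ [w [mw _] <-]; exact: measS_measurable.
have [A FA Amax] := exhaustion (muS G X) goodNE goodm.
have /choice[w wA] : forall n, exists w, good w /\ cofiber C w = A n.
  by move=> n; have [w gw <-] := FA n; exists w.
pose U := \bigcup_n A n.
have mU : measS G U.
  apply: measurable_measS; apply: bigcupT_measurable => n.
  by apply: goodm; exact: (FA n).
have UQ : {ae muS G X, forall x, ~ (U `\` Q) x}.
  apply/(@negl_ae _ (U `\` Q)); rewrite /U setD_bigcupl.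
  by apply: negligible_bigcup => n; have [[_ +] <-] := wA n.
have mQU : measS G (Q `\` U) by exact: measSD.
have [mleftQU _] := measS_leftp W mQU.
(* The cofiber over a good [v] lies in [U] up to a null set, so cutting [C] down to the complement
   of [U] leaves null cofibers, and hence null fibers. *)
have QU : {ae muS G X, forall x,
    negl (fiber (C `&` @leftp k V X W @^-1` (Q `\` U)) x)}.
  have mD : measS G (C `&` @leftp k V X W @^-1` (Q `\` U)) by exact: measSI.
  have [_ _ [+ _]] := fubini_fiber mD; apply.
  have [_ _ [_ +]] := fubini_cofiber mD; apply.
  apply: filterS goodE => v gv.
  have /Amax : [set cofiber C w | w in good] (cofiber C v) by exists v.
  by apply: negligibleS => x [Cx [_ nUx]].
exists w; move: QE UQ QU; apply: filterS3 => x QxE nUQ nQU.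
rewrite -QxE; split => [[j Cj]|Qx].
  apply: contrapT => nQx; apply: nUQ; split => //.
  by exists j => //; have [_ <-] := wA j.
apply: contrapT => nj; apply: (QxE.1 Qx).
apply: negligibleS nQU => v Cv; split => //; split => // -[j _].
by have [_ <-] := wA j => Cj; apply: nj; exists j.
Qed.

End Fubini.

(** * Enumeration of positions, and sets obtained by substituting into coordinates of [E] *)

Lemma enum_sum (S T : finType) :
  enum {: S + T} = map inl (enum S) ++ map inr (enum T).
Proof. by rewrite !enumT [in LHS]unlock. Qed.

Lemma enum_set_sum (S T : finType) (A : {set S + T}) :
  enum A = map inl (enum [set i | inl i \in A]%SET) ++
           map inr (enum [set j | inr j \in A]%SET).
Proof.
have enumE (U : finType) (B : {set U}) : enum B = seq.filter (mem B) (enum {: U}).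
  by rewrite {1}/enum_mem -enumT.
rewrite enumE enum_sum filter_cat (filter_map inl) (filter_map inr).
rewrite !(enumE _ [set _ | _]%SET).
by congr cat; congr map; apply: eq_filter => i; rewrite /= inE.
Qed.

Lemma map_val_enum (T : finType) (P : pred T) :
  map val (enum {: {x | P x}}) = enum P.
Proof.
rewrite enumT unlock -[LHS]/(map val (pmap insub (Finite.enum T))).
rewrite pmap_filter; last exact: insubK.
by apply: eq_filter => x; exact: isSome_insub.
Qed.

(** [merge b] takes its coordinates in [I] from the coordinates of [b] in [J],
    along [g], and the others from [w0]. *)
Section Substitution.
Context (R : realType) (k : nat) (V : 'I_k -> pointedType)
  (G : gradedProbSpace R V).
Context (W S : gsort k) (E : set (pt V W)) (w0 : pt V W)
  (I : {set pos W}) (J : {set pos S}) (g : pos S -> pos W)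
  (merge : pt V S -> pt V W).
Hypothesis gJ : map g (enum J) = enum I.
Hypothesis merge_in : forall b t,
  t \in J -> Tagged V (merge b (g t)) = Tagged V (b t).
Hypothesis merge_notin : forall b u, u \notin I -> merge b u = w0 u.

Lemma coords_restrp (X : gsort k) (K : {set pos X}) (p : pt V X) :
  coords (restrp K p) = [seq Tagged V (p u) | u <- enum K].
Proof.
rewrite /coords [enum (mem K)](_ : _ = map val (enum {: {t | t \in K}})).
  by rewrite -map_comp.
by rewrite map_val_enum.
Qed.

Let D := subfiber E (restrp (~: I) w0).

Let DE b c : D c ->
  (forall u : {u | u \in I}, Tagged V (c u) = Tagged V (merge b (val u))) ->
  E (merge b).
Proof.
move=> [w [Ew ww0] <-] wb; suff <- : w = merge b by [].
apply: pt_ext => u; have [uI|uI] := boolP (u \in I).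
  exact: (wb (exist _ u uI)).
have uI' : u \in ~: I by rewrite inE.
rewrite merge_notin//; congr Tagged.
exact: (congr1 (fun q : pt V (subS (~: I)) => q (exist _ u uI')) ww0).
Qed.

Let DmergE b : E (merge b) -> D (restrp I (merge b)).
Proof.
move=> Eb; exists (merge b) => //; split => //=.
apply: pt_ext => -[u uI] /=; rewrite /restrp /= merge_notin//.
by rewrite inE in uI.
Qed.

(** The condition [E (merge b)] says that the coordinates of [b] in [J], read in order, form a point
    of the fiber of [E] over the coordinates of [w0] outside [I]. This is a single constraint,
    whence [N = 1]. *)
Lemma fibersN_merge : fibersN E S 1 [set b | E (merge b)].
Proof.
exists (fun=> J), (fun=> I), (fun=> D); split.
- move=> _; rewrite -gJ -map_comp; apply/eq_in_map => t; rewrite mem_enum => tJ.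
  by have /(congr1 (fun u => projT1 u)) /= -> := merge_in (fun=> point) tJ.
- by move=> _; exists (restrp (~: I) w0); left.
- have gE b : [seq Tagged V (merge b u) | u <- enum I] =
              [seq Tagged V (b t) | t <- enum J].
    rewrite -gJ -map_comp; apply/eq_in_map => t; rewrite mem_enum; exact: merge_in.
  apply/seteqP; split => b /=.
    move=> Eb _; exists (restrp I (merge b)); first exact: DmergE.
    by rewrite !coords_restrp gE.
  move=> /(_ ord0)[c Dc cb]; apply: (DE Dc) => u.
  have [w _ cE] := Dc; move: cb; rewrite -cE !coords_restrp -gE => /eq_in_map.
  by apply; rewrite mem_enum; exact: valP.
Qed.

(** The set is the preimage of a measurable fiber of [E] under a coordinate map, whose position map
    picks for each [u] in [I] some [t] in [J] with [g t = u]. *)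
Lemma measS_merge : fibers_measurable G E -> measS G [set b | E (merge b)].
Proof.
move=> mE; have gI (u : {u | u \in I}) : exists2 t, t \in J & g t = val u.
  have : val u \in map g (enum J) by rewrite gJ mem_enum; exact: valP.
  by case/mapP => t; rewrite mem_enum => tJ ->; exists t.
pose s (u : pos (subS I)) : pos S := s2val (cid2 (gI u)).
have sJ u : s u \in J by exact: (s2valP (cid2 (gI u))).
have sE u : g (s u) = val u by exact: (s2valP' (cid2 (gI u))).
have -> : [set b | E (merge b)] = (fun b => restrp I (merge b)) @^-1` D.
  apply/seteqP; split => b /=; first exact: DmergE.
  by move=> Db; exact: (DE Db).
apply: (@measS_preimage _ _ _ _ _ _ s).
- by move=> u v suv; apply: val_inj; rewrite -!sE suv.
- by move=> b u; rewrite -(merge_in b (sJ u)) sE.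
- by apply: mE; exists (restrp (~: I) w0); left.
Qed.

End Substitution.

(** * The sigma-algebra generated by the fibers over [z] and over [(y, z)] *)

Section SliceAlgebra.
Context (R : realType) (k : nat) (V : 'I_k -> pointedType)
  (G : gradedProbSpace R V).
Context (X Y Z : gsort k) (E : set (pt V (prodS X (prodS Y Z)))).

Definition E3 (x : pt V X) (y : pt V Y) (z : pt V Z) : Prop :=
  E (pairp x (pairp y z)).

(** The second family is what the first becomes when the [Y] coordinate is frozen; it makes the
    generated algebra stable under substituting a fixed [y]. *)
Definition slices : set_system (pt V (prodS X Y)) :=
  [set A | (exists z, A = [set p | E3 (leftp p) (rightp p) z]) \/
           (exists y z, A = [set p | E3 (leftp p) y z])].

Definition slice_algebra : set_system (pt V (prodS X Y)) := <<s slices >>.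

Lemma slice_algebraI A B :
  slice_algebra A -> slice_algebra B -> slice_algebra (A `&` B).
Proof. exact: (@measurableI _ (g_sigma_algebraType slices)). Qed.

Lemma slice_algebraD A B :
  slice_algebra A -> slice_algebra B -> slice_algebra (A `\` B).
Proof. exact: (@measurableD _ (g_sigma_algebraType slices)). Qed.

Lemma slice_algebraC A : slice_algebra A -> slice_algebra (~` A).
Proof. exact: (@measurableC _ (g_sigma_algebraType slices)). Qed.

Lemma slice_algebra_bigcup (A : nat -> set (pt V (prodS X Y))) :
  (forall n, slice_algebra (A n)) -> slice_algebra (\bigcup_n A n).
Proof. exact: sigma_algebra_bigcup. Qed.

Lemma slice_algebra_slice z : slice_algebra [set p | E3 (leftp p) (rightp p) z].
Proof. by apply: sub_sigma_algebra; left; exists z. Qed.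

Lemma slice_algebra_cylinder y z : slice_algebra [set p | E3 (leftp p) y z].
Proof. by apply: sub_sigma_algebra; right; exists y, z. Qed.

(** The sets whose preimage under the substitution lies in the algebra form a sigma-algebra, and it
    contains the generators, which all become cylinders. *)
Lemma slice_algebra_subst A y :
  slice_algebra A -> slice_algebra [set p | A (pairp (leftp p) y)].
Proof.
pose f (p : pt V (prodS X Y)) : pt V (prodS X Y) := pairp (leftp p) y.
have := sigma_algebra_image f (smallest_sigma_algebra setT slices).
set F := image_set_system _ _ _ => Fs.
have sub : slices `<=` F.
  move=> _ [[z ->]|[y' [z ->]]]; rewrite /F /image_set_system /= setTI.
  - exact: slice_algebra_cylinder.
  - exact: slice_algebra_cylinder.
by move=> /(smallest_sub Fs sub); rewrite /F /image_set_system /= setTI.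
Qed.

Let IXY : {set pos (prodS X (prodS Y Z))} :=
  [set t : pos (prodS X (prodS Y Z)) | if t is inr (inr _) then false else true].

Let IX : {set pos (prodS X (prodS Y Z))} :=
  [set t : pos (prodS X (prodS Y Z)) | if t is inl _ then true else false].

Let JX : {set pos (prodS X Y)} :=
  [set t : pos (prodS X Y) | if t is inl _ then true else false].

Let g (t : pos (prodS X Y)) : pos (prodS X (prodS Y Z)) :=
  match t with inl i => inl i | inr j => inr (inl j) end.

Let gXY : map g (enum [set: pos (prodS X Y)]%SET) = enum IXY.
Proof.
rewrite 2!enum_set_sum map_cat -!map_comp [X in _ = _ ++ map _ X]enum_set_sum.
have -> : [set j : pos Z | inr j \in [set l | inr l \in IXY]]%SET = finset.set0.
  by apply/setP => i; rewrite !inE.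
rewrite enum_set0 cats0 -map_comp.
by congr (_ ++ _); congr map; apply: eq_enum => i; rewrite !inE.
Qed.

Let gX : map g (enum JX) = enum IX.
Proof.
rewrite 2!enum_set_sum map_cat -!map_comp.
have -> : [set j : pos Y | inr j \in JX]%SET = finset.set0.
  by apply/setP => i; rewrite !inE.
have -> : [set j : pos (prodS Y Z) | inr j \in IX]%SET = finset.set0.
  by apply/setP => i; rewrite !inE.
rewrite !enum_set0 !cats0.
by congr map; apply: eq_enum => i; rewrite !inE.
Qed.

Let mergeXY (z : pt V Z) (p : pt V (prodS X Y)) : pt V (prodS X (prodS Y Z)) :=
  pairp (leftp p) (pairp (rightp p) z).

Let mergeX (y : pt V Y) (z : pt V Z) (p : pt V (prodS X Y)) :
  pt V (prodS X (prodS Y Z)) := pairp (leftp p) (pairp y z).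

Lemma slice_algebra_fiber_algebra :
  slice_algebra `<=` fiber_algebra E (prodS X Y).
Proof.
apply: smallest_sub; first exact: smallest_sigma_algebra.
move=> _ [[z ->]|[y [z ->]]]; apply: sub_sigma_algebra; exists 1%N => //.
  (* Only the [Z] coordinates of [w0] matter here, the others being overwritten; [point] fills them
     in. *)
  - refine (fibersN_merge (w0 := mergeXY z (fun=> point))
      (merge := mergeXY z) E gXY _ _).
    + by move=> b [].
    + by move=> b [i|[j|l]]; rewrite inE.
  - refine (fibersN_merge (w0 := mergeX y z (fun=> point))
      (merge := mergeX y z) E gX _ _).
    + by move=> b [i|j]; rewrite inE.
    + by move=> b [i|[j|l]]; rewrite inE.
Qed.

Lemma slice_algebra_measS : fibers_measurable G E -> slice_algebra `<=` measS G.
Proof.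
move=> mE; apply: smallest_sub; first exact: sigma_algebra_measS.
move=> _ [[z ->]|[y [z ->]]].
- refine (measS_merge (w0 := mergeXY z (fun=> point))
      (merge := mergeXY z) gXY _ _ mE).
  + by move=> b [].
  + by move=> b [i|[j|l]]; rewrite inE.
- refine (measS_merge (w0 := mergeX y z (fun=> point))
      (merge := mergeX y z) gX _ _ mE).
  + by move=> b [i|j]; rewrite inE.
  + by move=> b [i|[j|l]]; rewrite inE.
Qed.

End SliceAlgebra.

(** * Words indexing the nodes of a tree, split into first letter and rest *)

Section Words.

(** Plain sequences let words be compared without casts between tuple types of different lengths. *)
Definition short_seq d (w : short_word d) : seq bool := tagged w.

Lemma short_seq_size d (w : short_word d) : (size (short_seq w) < d)%N.
Proof. by rewrite /short_seq size_tuple. Qed.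

Lemma short_seq_inj d : injective (@short_seq d).
Proof.
move=> [[m md] u] [[n nd] v]; rewrite /short_seq /= => uv.
have mn : m = n by rewrite -[m](size_tuple u) -[n](size_tuple v) uv.
by subst n; rewrite (bool_irrelevance nd md) (val_inj uv).
Qed.

Lemma short_word0 (w : short_word 0) : False.
Proof. by have := short_seq_size w. Qed.

Definition word_of d (s : seq bool) (h : (size s < d)%N) : short_word d :=
  Tagged (fun n : 'I_d => n.-tuple bool) (i := Ordinal h) (in_tuple s).

(** [None] is the root of a tree of depth [d + 1]; otherwise the letter names the subtree and the
    word a node in it. The match carries the size bound along, since it bounds the tail by
    conversion. *)
Definition word_split d (w : short_word d.+1) : option (bool * short_word d) :=
  match short_seq w as s return (size s < d.+1)%N -> option (bool * short_word d)
  with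
  | [::] => fun=> None
  | b :: s => fun h => Some (b, word_of (s := s) h)
  end (short_seq_size w).

Lemma word_splitE d (w : short_word d.+1) :
  short_seq w = if word_split w is Some (b, u) then b :: short_seq u else [::].
Proof.
rewrite /word_split; move: (short_seq_size w).
by case: (short_seq w).
Qed.

Lemma word_split_inj d : injective (@word_split d).
Proof. by move=> u v uv; apply: short_seq_inj; rewrite !word_splitE uv. Qed.

Lemma short_seq_prefix d (s : d.-tuple bool) (i : 'I_d) :
  short_seq (prefix_word s i) = take i s.
Proof.
rewrite /short_seq /=; apply: (@eq_from_nth _ false).
  by rewrite size_map size_enum_ord size_takel// size_tuple ltnW.
move=> j; rewrite size_map size_enum_ord => ji.
rewrite nth_take// (nth_map (Ordinal ji)) ?size_enum_ord//.
by rewrite (tnth_nth false) /= nth_enum_ord.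
Qed.

Lemma word_split_prefix0 d (s : d.+1.-tuple bool) :
  word_split (prefix_word s ord0) = None.
Proof.
have := word_splitE (prefix_word s ord0); rewrite short_seq_prefix take0.
by case: (word_split _) => [[]|].
Qed.

Lemma word_split_prefix d (s : d.+1.-tuple bool) (i : 'I_d) :
  word_split (prefix_word s (lift ord0 i)) =
  Some (thead s, prefix_word (behead_tuple s) i).
Proof.
have := word_splitE (prefix_word s (lift ord0 i)).
have -> : short_seq (prefix_word s (lift ord0 i)) =
          thead s :: take i (behead_tuple s).
  by rewrite short_seq_prefix lift0 {1}(tuple_eta s).
case: (word_split _) => [[b u] [-> e]|//].
by congr (Some (_, _)); apply: short_seq_inj; rewrite -e short_seq_prefix.
Qed.

End Words.

(** * Splitting sets and the joining of two trees below a common root *)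

Section Main.
Context (R : realType) (k : nat) (V : 'I_k -> pointedType)
  (G : gradedProbSpace R V).
Context (X Y Z : gsort k) (E : set (pt V (prodS X (prodS Y Z)))).

Local Notation negl := (muS G _).-negligible.

Definition split_set (B : set (pt V (prodS X Y))) :
    set (pt V (prodS X (prodS Z (prodS Y Y)))) :=
  [set p | let x := leftp p in let z := leftp (rightp p) in
    let y0 := leftp (rightp (rightp p)) in
    let y1 := rightp (rightp (rightp p)) in
    (B (pairp x y0) /\ ~ E3 E x y0 z) /\ (B (pairp x y1) /\ E3 E x y1 z)].

Definition leaf_tree d (B : set (pt V (prodS X Y))) :
    set (pt V (prodS X (treeS Y Z d))) :=
  [set p | @tree k V Y Z (fiber E (leftp p)) d (rightp p) /\
    forall s, B (pairp (leftp p) (compp (leftp (rightp p)) s))].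

Arguments leaf_tree d B _ : clear implicits.

Definition slice z : set (pt V (prodS X Y)) :=
  [set p | E3 E (leftp p) (rightp p) z].

Definition tree_pair d (B : set (pt V (prodS X Y))) :
    set (pt V (prodS X (prodS Z (prodS (treeS Y Z d) (treeS Y Z d))))) :=
  [set p | let x := leftp p in let z := leftp (rightp p) in
    leaf_tree d (B `\` slice z) (pairp x (leftp (rightp (rightp p)))) /\
    leaf_tree d (B `&` slice z) (pairp x (rightp (rightp (rightp p))))].

Arguments tree_pair d B _ : clear implicits.

Definition join_trees d
    (q : pt V (prodS Z (prodS (treeS Y Z d) (treeS Y Z d)))) :
    pt V (treeS Y Z d.+1) :=
  fun t => match t with
  | inl t => if thead t.1 then rightp (rightp q) (inl (behead_tuple t.1, t.2))
             else leftp (rightp q) (inl (behead_tuple t.1, t.2))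
  | inr t => match word_split t.1 with
    | None => leftp q t.2
    | Some (b, w) => if b then rightp (rightp q) (inr (w, t.2))
                     else leftp (rightp q) (inr (w, t.2))
    end
  end.

Definition join_pos d (t : pos (treeS Y Z d.+1)) :
    pos (prodS Z (prodS (treeS Y Z d) (treeS Y Z d))) :=
  match t with
  | inl t => if thead t.1 then inr (inr (inl (behead_tuple t.1, t.2)))
             else inr (inl (inl (behead_tuple t.1, t.2)))
  | inr t => match word_split t.1 with
    | None => inl t.2
    | Some (b, w) => if b then inr (inr (inr (w, t.2)))
                     else inr (inl (inr (w, t.2)))
    end
  end.

Lemma thead_behead_inj d (s t : d.+1.-tuple bool) :
  thead s = thead t -> behead s = behead t -> s = t.
Proof.
case/tupleP: s => a s; case/tupleP: t => b t; rewrite !theadE => -> /= st.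
by apply: val_inj; rewrite /= st.
Qed.

(** A leaf or node word is determined by its first letter and its rest. Injectivity allows null sets
    of trees to be pulled back along [join_trees]. *)
Lemma join_pos_inj d : injective (@join_pos d).
Proof.
move=> [[s i]|[w i]] [[t j]|[v j]] /=.
- by case hs: (thead s); case ht: (thead t) => // -[st ->];
    congr (inl (_, _)); apply: thead_behead_inj; rewrite ?hs ?ht.
- by case: (thead s); case: (word_split v) => [[[] ?]|].
- by case: (thead t); case: (word_split w) => [[[] ?]|].
- case hw: (word_split w) => [[[] w']|]; case hv: (word_split v) => [[[] v']|] //.
  + by move=> [e ->]; congr (inr (_, _)); apply: word_split_inj; rewrite hw hv e.
  + by move=> [e ->]; congr (inr (_, _)); apply: word_split_inj; rewrite hw hv e.
  + by move=> [->]; congr (inr (_, _)); apply: word_split_inj; rewrite hw hv.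
Qed.

Lemma join_coordinate_map d : coordinate_map (@join_pos d) (@join_trees d).
Proof.
move=> q [[s i]|[w i]] /=; first by case: (thead s).
by case: (word_split w) => [[[] ?]|].
Qed.

Lemma join_leaf d q (s : d.+1.-tuple bool) :
  compp (leftp (join_trees q)) s =
  compp (leftp (if thead s then rightp (rightp q) else leftp (rightp q)))
    (behead_tuple s).
Proof.
apply: functional_extensionality_dep => i; rewrite /compp /leftp /=.
by case: (thead s).
Qed.

Lemma join_root d q (w : short_word d.+1) : word_split w = None ->
  compp (rightp (join_trees q)) w = leftp q.
Proof.
move=> hw; apply: functional_extensionality_dep => i.
by rewrite /compp /rightp /= hw.
Qed.

Lemma join_node d q (w : short_word d.+1) b u : word_split w = Some (b, u) ->
  compp (rightp (join_trees q)) w =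
  compp (rightp (if b then rightp (rightp q) else leftp (rightp q))) u.
Proof.
move=> hw; apply: functional_extensionality_dep => i.
rewrite /compp /rightp /= hw.
by case: b {hw}.
Qed.

(** At the root, the first letter of a leaf decides whether it lies in the slice at [z]; at deeper
    nodes, the condition is that of the subtree named by this letter. *)
Lemma tree_pair_join d B x q :
  tree_pair d B (pairp x q) -> leaf_tree d.+1 B (pairp x (join_trees q)).
Proof.
move=> [[t0 l0] [t1 l1]].
have lE (s : d.+1.-tuple bool) :
    B (pairp x (compp (leftp (join_trees q)) s)) /\
    (E3 E x (compp (leftp (join_trees q)) s) (leftp q) <-> thead s).
  rewrite join_leaf; case hs: (thead s).
    by have [Bs Es] := l1 (behead_tuple s); split.
  by have [Bs Es] := l0 (behead_tuple s); split.
split=> [s i|s]; last by have [] := lE s.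
have [->|[j ->]] : i = ord0 \/ exists j, i = lift ord0 j.
  by have [j ->|->] := unliftP ord0 i; [right; exists j|left].
  rewrite [compp (rightp _) _](join_root _ (word_split_prefix0 s)).
  exact: (lE s).2.
rewrite [compp (rightp _) _](join_node _ (word_split_prefix s j)).
rewrite [compp (leftp _) _]join_leaf.
have -> : tnth s (lift ord0 j) = tnth (behead_tuple s) j.
  by rewrite tnth_behead; congr tnth; apply: val_inj; rewrite /= inordK// ltnS.
by case: (thead s); [exact: t1|exact: t0].
Qed.

(** * Measurability of the sets of splits and of trees *)

Hypothesis mE : measS G E.

(** Disjoint injective position maps combine into one injective map, so this is a preimage of [E]
    under a coordinate map. *)
Lemma measS_E3 S (i : pos X -> pos S) (j : pos Y -> pos S) (l : pos Z -> pos S)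
    (f : pt V S -> pt V X) (g : pt V S -> pt V Y) (h : pt V S -> pt V Z) :
  injective i -> injective j -> injective l ->
  (forall a b, i a <> j b) -> (forall a b, i a <> l b) -> (forall a b, j a <> l b) ->
  coordinate_map i f -> coordinate_map j g -> coordinate_map l h ->
  measS G [set p | E3 E (f p) (g p) (h p)].
Proof.
move=> iI jI lI ij il jl fi gj hl.
apply: (@measS_preimage _ _ _ G S (prodS X (prodS Y Z)) (fun t => match t with
  | inl a => i a | inr (inl b) => j b | inr (inr c) => l c end)
  (fun p => pairp (f p) (pairp (g p) (h p)))) mE.
- move=> [a|[a|a]] [b|[b|b]] //.
  + by move/iI ->.
  + by move/ij.
  + by move/il.
  + by move/esym/ij.
  + by move/jI ->.
  + by move/jl.
  + by move/esym/il.
  + by move/esym/jl.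
  + by move/lI ->.
- by move=> p [a|[b|c]] /=.
Qed.

Lemma measS_pair S (A : set (pt V (prodS X Y))) (i : pos X -> pos S)
    (j : pos Y -> pos S) (f : pt V S -> pt V X) (g : pt V S -> pt V Y) :
  measS G A -> injective i -> injective j -> (forall a b, i a <> j b) ->
  coordinate_map i f -> coordinate_map j g ->
  measS G [set p | A (pairp (f p) (g p))].
Proof.
move=> mA iI jI ij fi gj.
apply: (@measS_preimage _ _ _ G S (prodS X Y) (fun t => match t with
  | inl a => i a | inr b => j b end) (fun p => pairp (f p) (g p))) mA.
- move=> [a|a] [b|b] //; first by move/iI ->.
  + by move/ij.
  + by move/esym/ij.
  + by move/jI ->.
- by move=> p [a|b] /=.
Qed.

Lemma measS_split_set B : measS G B -> measS G (split_set B).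
Proof.
move=> mB; pose S := prodS X (prodS Z (prodS Y Y)).
apply: measSI; apply: measSI.
- by apply: (@measS_pair S _ inl (fun j => inr (inr (inl j)))) => // a b [].
- apply: measSC.
  by apply: (@measS_E3 S inl (fun j => inr (inr (inl j)))
    (fun l => inr (inl l))) => // a b [].
- by apply: (@measS_pair S _ inl (fun j => inr (inr (inr j)))) => // a b [].
- by apply: (@measS_E3 S inl (fun j => inr (inr (inr j)))
    (fun l => inr (inl l))) => // a b [].
Qed.

Lemma measS_leaf_tree d B : measS G B -> measS G (leaf_tree d B).
Proof.
move=> mB; pose S := prodS X (treeS Y Z d).
apply: measSI; apply: measS_forall; last first.
  by move=> s; apply: (@measS_pair S _ inl (fun j => inr (inl (s, j)))) => // a b [].
move=> s; apply: measS_forall => i; apply: measS_iff.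
by apply: (@measS_E3 S inl (fun j => inr (inl (s, j)))
  (fun l => inr (inr (prefix_word s i, l)))) => // a b [].
Qed.

Lemma measS_tree_pair d B : measS G B -> measS G (tree_pair d B).
Proof.
move=> mB; pose S := prodS X (prodS Z (prodS (treeS Y Z d) (treeS Y Z d))).
pose f0 (p : pt V S) : pt V (prodS X (treeS Y Z d)) :=
  pairp (leftp p) (leftp (rightp (rightp p))).
pose f1 (p : pt V S) : pt V (prodS X (treeS Y Z d)) :=
  pairp (leftp p) (rightp (rightp (rightp p))).
have mf0 : measS G (f0 @^-1` leaf_tree d B).
  apply: (@measS_preimage _ _ _ G S (prodS X (treeS Y Z d)) (fun t =>
    match t with inl i => inl i | inr j => inr (inr (inl j)) end)).
  - by move=> [a|a] [b|b] // [->].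
  - by move=> p [].
  - exact: measS_leaf_tree.
have mf1 : measS G (f1 @^-1` leaf_tree d B).
  apply: (@measS_preimage _ _ _ G S (prodS X (treeS Y Z d)) (fun t =>
    match t with inl i => inl i | inr j => inr (inr (inr j)) end)).
  - by move=> [a|a] [b|b] // [->].
  - by move=> p [].
  - exact: measS_leaf_tree.
(* Since [z] varies with the point, [slice z] cannot be put into [measS_leaf_tree]; the conditions
   on the leaves at the root are separated from those given by [B]. *)
have mE0 : measS G [set p : pt V S | forall s : d.-tuple bool, ~ E3 E (leftp p)
    (compp (leftp (leftp (rightp (rightp p)))) s) (leftp (rightp p))].
  apply: measS_forall => s; apply: measSC.
  by apply: (@measS_E3 S inl (fun j => inr (inr (inl (inl (s, j)))))
    (fun l => inr (inl l))) => // a b [].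
have mE1 : measS G [set p : pt V S | forall s : d.-tuple bool, E3 E (leftp p)
    (compp (leftp (rightp (rightp (rightp p)))) s) (leftp (rightp p))].
  apply: measS_forall => s.
  by apply: (@measS_E3 S inl (fun j => inr (inr (inr (inl (s, j)))))
    (fun l => inr (inl l))) => // a b [].
suff -> : tree_pair d B = (f0 @^-1` leaf_tree d B `&`
    [set p : pt V S | forall s : d.-tuple bool, ~ E3 E (leftp p)
    (compp (leftp (leftp (rightp (rightp p)))) s) (leftp (rightp p))]) `&`
  (f1 @^-1` leaf_tree d B `&`
    [set p : pt V S | forall s : d.-tuple bool, E3 E (leftp p)
    (compp (leftp (rightp (rightp (rightp p)))) s) (leftp (rightp p))]).
  by apply: measSI; apply: measSI.
apply/seteqP; split => p.
- move=> [[t0 l0] [t1 l1]]; split; split => //.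
  + by split => // s; have [] := l0 s.
  + by move=> s; have [] := l0 s.
  + by split => // s; have [] := l1 s.
  + by move=> s; have [] := l1 s.
- move=> [[[t0 l0] e0] [[t1 l1] e1]]; split; split => //.
  + by move=> s; split; [exact: l0|exact: e0].
  + by move=> s; split; [exact: l1|exact: e1].
Qed.

(** * From stability to a countable cover with perfect fibers *)

Hypothesis mEf : fibers_measurable G E.

Let SA := slice_algebra E.

Let SAm B : SA B -> measS G B.
Proof. exact: slice_algebra_measS. Qed.

(** A tree of depth [d + 1] consists of a root [z] and two trees of depth [d],
    whose leaves are outside, respectively inside, the slice at [z]. *)
Lemma leaf_tree_negl (D : set (pt V (prodS X Y))) :
  (forall B, SA B -> B `<=` D -> {ae muS G X, forall x,
     negl (fiber (split_set B) x) -> negl (fiber B x)}) ->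
  forall d B, SA B -> B `<=` D -> {ae muS G X, forall x,
    negl (fiber (leaf_tree d B) x) -> negl (fiber B x)}.
Proof.
move=> Dsplit; elim=> [|d IHd] B SB BD.
  apply: aeW => x.
  (* A tree of depth 0 is a single leaf with no inner node, so [c] identifies [Y] with the trees,
     and the tree condition is vacuous. *)
  pose c (y : pt V Y) : pt V (treeS Y Z 0) := fun t =>
    match t return V (base (g := treeS Y Z 0) t) with
    | inl t => y t.2
    | inr t => False_rect _ (short_word0 t.1)
    end.
  pose i (t : pos (treeS Y Z 0)) : pos Y := match t with
    | inl t => t.2
    | inr t => False_rect _ (short_word0 t.1)
    end.
  have iI : injective i.
    move=> [[s a]|[w ?]]; last by case: (short_word0 w).
    move=> [[t b]|[w ?]] /=; last by case: (short_word0 w).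
    by move=> ->; rewrite (tuple0 s) (tuple0 t).
  have ci : coordinate_map i c by move=> y [|[w ?]] //=; case: (short_word0 w).
  move/(negl_preimage iI ci); apply: negligibleS => y By.
  by split => [s []|s] //.
have mB := SAm SB.
(* For fixed [z] both fibers are contained in, or contain, rectangles. A null rectangle of trees has
   a null side, which the induction hypothesis, applied to [B] outside or inside the slice, turns
   into a null side of the splitting rectangle. *)
have step : {ae muS G X, forall x,
    negl (fiber (tree_pair d B) x) -> negl (fiber (split_set B) x)}.
  apply: negl_fiber_trans; [exact: measS_split_set|exact: measS_tree_pair|].
  move=> z; have sz : SA (slice z) by exact: slice_algebra_slice.
  have h0 := IHd (B `\` slice z) (slice_algebraD SB sz)
    (subset_trans (@subIsetl _ _ _) BD).
  have h1 := IHd (B `&` slice z) (slice_algebraI SB sz)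
    (subset_trans (@subIsetl _ _ _) BD).
  move: h0 h1; apply: filterS2 => x h0 h1 nU.
  have /negl_rect nr : negl (rect (fiber (leaf_tree d (B `\` slice z)) x)
      (fiber (leaf_tree d (B `&` slice z)) x)).
    by apply: negligibleS nU => q [].
  have /rect_negl : negl (fiber (B `\` slice z) x) \/
                    negl (fiber (B `&` slice z) x).
    by case: nr => [/h0|/h1]; [left|right].
  by apply: negligibleS => q [].
move: (Dsplit B SB BD) step; apply: filterS2 => x h1 h2 nT.
apply/h1/h2; have := negl_preimage (@join_pos_inj d) (@join_coordinate_map d) nT.
by apply: negligibleS => q; exact: tree_pair_join.
Qed.

Lemma split_setS A B : A `<=` B -> split_set A `<=` split_set B.
Proof. by move=> AB p [[Ay nE0] [Ay' E1]]; split; split => //; exact: AB. Qed.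

(** Over [(x, z)] the splitting set is the rectangle of the parts of the fiber outside and inside
    the cofiber at [z]; being null, it has a null side, which is the alternative defining
    perfection. *)
Lemma perfect_fiber A : SA A ->
  {ae muS G X, forall x, negl (fiber (split_set A) x)} ->
  {ae muS G X, forall x, perfect_for G (fiber E x) (fiber A x)}.
Proof.
move=> /SAm mA; have [mAx _ _] := fubini_fiber mA.
have [mEx _ _] := fubini_fiber mE.
move: mAx mEx; apply: filterS3 => x mAx mEx nx; split => //.
have [mExz _ _] := fubini_cofiber mEx.
move: (negl_fiber nx) mExz; apply: filterS2 => z nz mz.
have : negl (rect (fiber A x `\` cofiber (fiber E x) z)
                  (fiber A x `&` cofiber (fiber E x) z)).
  by apply: negligibleS nz => q [].
case/negl_rect => n; [right|left]; apply/negl_measS => //.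
  exact: measSD.
exact: measSI.
Qed.

(** Positivity of the measure of a fiber is detected by countably many points,
    so the bad [x] form, up to a null set, a set in the slice algebra. *)
Lemma remove_split B : SA B -> exists P : set (pt V X),
  SA (B `\` @leftp k V X Y @^-1` P) /\
  {ae muS G X, forall x, P x <-> ~ negl (fiber (split_set B) x)}.
Proof.
move=> SB; have [w wE] := countable_hitting_points (measS_split_set (SAm SB)).
exists [set x | exists j, split_set B (pairp x (w j))]; split => //.
apply: slice_algebraD => //.
(* With [w j] fixed, each condition on [x] is a substitution into [B] or a cylinder, hence in the
   algebra. *)
rewrite (_ : _ @^-1` _ = \bigcup_j [set p | split_set B (pairp (leftp p) (w j))]).
  apply: slice_algebra_bigcup => j; apply: slice_algebraI.
    apply: slice_algebraI; first exact: slice_algebra_subst.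
    by apply: slice_algebraC; exact: slice_algebra_cylinder.
  by apply: slice_algebraI;
    [exact: slice_algebra_subst|exact: slice_algebra_cylinder].
by apply/seteqP; split => p [j]; [exists j|move=> _ ?; exists j].
Qed.

Hypothesis stableE :
  {ae muS G X, forall x, measS G (fiber E x) /\ mu_stable G (fiber E x)}.

Lemma exists_perfect_cover : exists A : nat -> set (pt V (prodS X Y)),
  [/\ forall n, SA (A n), \bigcup_n A n = setT &
    forall n, {ae muS G X, forall x, negl (fiber (split_set (A n)) x)}].
Proof.
pose F := [set A | SA A /\
  {ae muS G X, forall x, negl (fiber (split_set A) x)}].
have F0 : F !=set0.
  exists set0; split; first exact: sigma_algebra0.
  by apply: aeW => x; apply: negligibleS (negligible_set0 _) => q [[]].
have Fm : F `<=`
    @measurable _ (g_sigma_algebraType (@measS R k V G (prodS X Y))).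
  by move=> A [/SAm/measS_measurable].
have [A FA Amax] := exhaustion (muS G (prodS X Y)) F0 Fm.
pose D := ~` \bigcup_n A n.
have SD : SA D.
  by apply: slice_algebraC; apply: slice_algebra_bigcup => n; have [] := FA n.
(* Without the [x] in [P], [B] belongs to [F], so what remains is null off the [A n], hence null, as
   [B] avoids them. For [x] outside [P] the whole fiber of [B] remains. *)
have Dsplit B : SA B -> B `<=` D -> {ae muS G X, forall x,
    negl (fiber (split_set B) x) -> negl (fiber B x)}.
  move=> SB BD; have [P [SP PE]] := remove_split SB.
  have /Amax/negl_fiber : F (B `\` @leftp k V X Y @^-1` P).
    split => //; apply: filterS PE => x Px.
    have [xP|xP] := pselect (P x).
      by apply: negligibleS (negligible_set0 _) => q [[[_ /(_ xP)]]].
    have /contrapT : ~ ~ negl (fiber (split_set B) x) by move/Px.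
    by apply: negligibleS => q; apply: split_setS => p [].
  move: PE; apply: filterS2 => x Px nx nBx.
  apply: negligibleS nx => y By; split; last exact: BD.
  by split => // /Px; apply.
have Dnull : {ae muS G X, forall x, negl (fiber D x)}.
  (* The depth given by stability depends on [x], so the implication is needed for all depths at
     once. *)
  have := ae_foralln (fun d => leaf_tree_negl Dsplit d SD (@subset_refl _ D)).
  have mT : {ae muS G X, forall x, forall d,
      measS G (fiber (leaf_tree d setT) x)}.
    apply: ae_foralln => d.
    by have [] := fubini_fiber (measS_leaf_tree d (measST G _)).
  move: mT stableE; apply: filterS3 => x mT [_ [d _ Ed]] /(_ d); apply.
  have : negl (fiber (leaf_tree d setT) x).
    apply/negl_measS => //; rewrite -[RHS]Ed; congr (muS G _ _).
    by apply/seteqP; split => [t []|t].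
  by apply: negligibleS => t [].
(* The remainder [D] goes first, so that the cover is exact; its null fibers make its splitting set
   null as well. *)
exists (fun n => if n is m.+1 then A m else D); split.
- by case=> [|n] //; have [] := FA n.
- apply/seteqP; split => // p _.
  have [[n _ Ap]|Dp] := pselect ((\bigcup_n A n) p); first by exists n.+1.
  by exists 0%N.
- case=> [|n]; last by have [] := FA n.
  apply: filterS Dnull => x.
  move=> /(@negl_leftp _ _ _ G Y Y)/(@negl_rightp _ _ _ G Z (prodS Y Y)).
  by apply: negligibleS => q [[]].
Qed.

End Main.

Theorem theorem5p1 (R : realType) (k : nat) (V : 'I_k -> pointedType)
    (G : gradedProbSpace R V) (X Y Z : gsort k)
    (E : set (pt V (prodS X (prodS Y Z)))) :
  measS G E ->
  fibers_measurable G E ->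
  {ae muS G X, forall x, measS G (fiber E x) /\ mu_stable G (fiber E x)} ->
  exists A : nat -> set (pt V (prodS X Y)),
    [/\ forall i, fiber_algebra E (prodS X Y) (A i),
        countable_partition A
      & {ae muS G X, forall x,
          countable_partition (fun i => fiber (A i) x) /\
          forall i, perfect_for G (fiber E x) (fiber (A i) x)}].
Proof.
move=> mE mEf stableE.
have [A [SA coverA nA]] := exists_perfect_cover mE mEf stableE.
(* Making the cover disjoint keeps it in the algebra and only shrinks the splitting sets, so
   perfection survives. *)
have SD n : slice_algebra E (seqDU A n).
  exact: (@seqDU_measurable _ (g_sigma_algebraType (slices E)) A SA).
have partA : countable_partition (seqDU A).
  by split; [exact: trivIset_seqDU|rewrite -seqDU_bigcup_eq].
exists (seqDU A); split => //.
  by move=> i; apply: slice_algebra_fiber_algebra.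
have perfA : {ae muS G X, forall x,
    forall i, perfect_for G (fiber E x) (fiber (seqDU A i) x)}.
  apply: ae_foralln => i; apply: perfect_fiber => //.
  apply: filterS (nA i) => x; apply: negligibleS => q.
  by apply: split_setS; exact: subset_seqDU.
apply: filterS perfA => x perfx; split => //.
have [tA cA] := partA; split.
  by move=> i j _ _ [y [yi yj]]; apply: tA => //; exists (pairp x y).
apply/seteqP; split => // y _.
have [i _ Ai] : (\bigcup_i seqDU A i) (pairp x y) by rewrite cA.
by exists i.
Qed.
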